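(* Let $t$ be a table with $n\ge 2$ rows, and fix a predicate such that exactly $pn$ rows of $t$ satisfy it, where $p\in(0,1]$. Draw a sample of $k$ rows, $1\le k<n$, uniformly at random without replacement from $t$, let $\hat X$ be the number of sampled rows satisfying the predicate, and estimate the cardinality by $\mathrm{est}=\frac{n}{k}\hat X$, the true cardinality being $\mathrm{true}=pn$. Let $\sigma^2=p(1-p)$ (and $\sigma=\sqrt{p(1-p)}$), and define $$\rho=\begin{cases}1-\frac{k-1}{n} & \text{if } k\le n/2,\\ \big(1-\frac kn\big)\big(1+\frac1k\big) & \text{if } k>n/2,\end{cases}\qquad \zeta=\begin{cases}\frac43+\sqrt{\frac{k(k-1)}{n(n-k+1)}} & \text{if } k\le n/2,\\ \frac43+\sqrt{\frac{(n-k-1)(n-k)}{(k+1)n}} & \text{if } k>n/2.\end{cases}$$ Then for every $q\ge 1$, $$\mathbb{P}(\text{Q-error}\le q)\ \ge\ 1-\Omega-\Psi,$$ where $$\Omega=\min\Bigg(2\exp\Big(-\frac{k}{\zeta^2}\big(-\sqrt{2\zeta\rho\sigma^2(pq-p)+\rho^2\sigma^4}+(pq-p)\zeta+\sigma^2\rho\big)\Big),\ \exp\Big(-\frac{2k(pq-p)^2}{\rho}\Big)\Bigg),$$ $$\Psi=\min\Bigg(2\exp\Big(-\frac{k}{\zeta^2}\big(-\sqrt{2\zeta\rho\sigma^2(p-p/q)+\rho^2\sigma^4}+(p-p/q)\zeta+\sigma^2\rho\big)\Big),\ \exp\Big(-\frac{2k(p-p/q)^2}{\rho}\Big)\Bi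gg).$$
   Context: The Q-error of an estimate is $\max\big(\frac{\mathrm{true}'}{\mathrm{est}'},\frac{\mathrm{est}'}{\mathrm{true}'}\big)$, where $\mathrm{est}'=\max(\mathrm{est},1)$ and $\mathrm{true}'=\max(\mathrm{true},1)$ (to avoid division by zero). $\Omega$ bounds the probability of over-estimation ($\mathrm{est}\ge q\cdot\mathrm{true}$) and $\Psi$ the probability of under-estimation ($\mathrm{est}\le \mathrm{true}/q$). *)

(* Defs.v *)
(* R : realType (mathcomp-analysis), discrete uniform sampling
   without replacement modelled as the uniform distribution on k-subsets of 'I_n. *)
From mathcomp Require Import all_boot all_order all_algebra.
From mathcomp Require Import reals.
From mathcomp Require Import sequences exp.
Set Implicit Arguments. Unset Strict Implicit. Unset Printing Implicit Defensive.
Import Order.TTheory GRing.Theory Num.Theory.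
Local Open Scope ring_scope.

Section Defs.
Variable R : realType.

(* Q-error with the max(.,1) clamping from the paper *)
Definition qerror (est tru : R) : R :=
  let e := Num.max est 1 in let t := Num.max tru 1 in Num.max (t / e) (e / t).

Definition rho_ (n k : nat) : R :=
  if (k%:R <= n%:R / 2 :> R) then 1 - (k%:R - 1) / n%:R
  else (1 - k%:R / n%:R) * (1 + 1 / k%:R).

Definition zeta_ (n k : nat) : R :=
  if (k%:R <= n%:R / 2 :> R) then
    4 / 3 + Num.sqrt ((k%:R * (k%:R - 1)) / (n%:R * (n%:R - k%:R + 1)))
  else 4 / 3 + Num.sqrt (((n%:R - k%:R - 1) * (n%:R - k%:R)) / ((k%:R + 1) * n%:R)).

Definition tail_bound (n k : nat) (p d : R) : R :=
  let s2 := p * (1 - p) in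
  let r := rho_ n k in let z := zeta_ n k in
  Num.min
    (2 * expR (- (k%:R / z ^+ 2) *
       (- Num.sqrt (2 * z * r * s2 * d + r ^+ 2 * s2 ^+ 2) + d * z + s2 * r)))
    (expR (- (2 * k%:R * d ^+ 2) / r)).

Definition Omega (n k : nat) (p q : R) : R := tail_bound n k p (p * q - p).
Definition Psi (n k : nat) (p q : R) : R := tail_bound n k p (p - p / q).

(* Probability, under uniform sampling of k distinct rows of a table with n rows,
   that the Q-error of est = (n/k) * Xhat w.r.t. true = p n is at most q;
   sel i = whether row i satisfies the predicate. *)
Definition prob_qerror_le (n k : nat) (sel : pred 'I_n) (p q : R) : R :=
  #|[set S : {set 'I_n} | (#|S| == k) &&
      (qerror (n%:R / k%:R * (#|S :&: [set i | sel i]|)%:R) (p * n%:R) <= q)]|%:R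
  / ('C(n, k))%:R.

End Defs.

(* Main.v *)
(* Everything reduces to tail bounds for the number X of hits in the sample, whose
   mean is k p; the under-estimation tail is the over-estimation tail of the
   complementary predicate.  Both tails come from Chernoff's method.
   For Hoeffding-Serfling, drawing one more row gives the recursion
     log M_(k+1)(l) <= log M_k(l (n-k-1)/(n-k)) + l^2/8,
   and l^2/8 * k(n-k+1)/n is a supersolution of it; exchanging the sample with its
   complement replaces k by n-k, and the better of the two bounds is k rho.
   For Bernstein, the swap of a sampled row with an unsampled one is reversible,
   which yields n E[(X-kp) g(X)] = E[(k-X)(K-X)(g(X+1)-g(X))], K = pn.  With
   g = exp(l .), the rate (k-X)(K-X) is decreasing while g is increasing, so
   Chebyshev's association inequality gives M' <= Var(X) (e^l - 1) M, hence
   log M <= Var(X) (e^l - 1 - l).  This suffices, as Var(X) <= k rho sigma^2, zeta >= 1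
   and (1 - l) (e^l - 1 - l) <= l^2/2. *)
From mathcomp Require Import boolp classical_sets functions topology normedtype.
From mathcomp Require Import derive realfun.
Require Import Defs.
From mathcomp Require Import all_boot all_order all_algebra.
From mathcomp Require Import reals.
From mathcomp Require Import sequences exp.
From mathcomp Require Import ring lra.
Set Implicit Arguments. Unset Strict Implicit. Unset Printing Implicit Defensive.
Import Order.TTheory GRing.Theory Num.Theory.
Import numFieldNormedType.Exports.
Local Open Scope ring_scope.

(** * Exponential inequalities *)

Lemma is_derive_le0_le (R : realType) (f df : R -> R) (x : R) :
  (forall y : R, is_derive y 1 f (df y)) -> (forall y : R, 0 <= y -> df y <= 0) ->
  0 <= x -> f x <= f 0.
Proof.
move=> fdf df0 x0.
have cf : {within `[0, x], continuous f}%classic.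
  apply: derivable_within_continuous => y _.
  by have [] := fdf y.
have [c /[!in_itv]/= /andP[c0 _]] := MVT_segment x0 (fun y _ => fdf y) cf.
by rewrite subr0 => fE; rewrite -subr_le0 fE mulr_le0_ge0 ?df0.
Qed.

Lemma is_derive_expRM (R : realType) (a x : R) :
  is_derive x 1 (fun l => expR (l * a)) (a * expR (x * a)).
Proof.
have h : is_derive x (1 : R) (fun l : R => l * a) a.
  have := is_deriveM (is_derive_id x (1:R)) (is_derive_cst a x (1:R)).
  by move/is_derive_eq; apply; rewrite scaler0 add0r /GRing.scale /= mulr1.
have := @is_derive1_comp R expR (fun l => l * a) x _ _ (is_derive_expR _) h.
by rewrite mulrC.
Qed.

(** A rearrangement of [(1 - l) (e^l - 1 - l) <= l^2/2]; the difference of the two sides has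
    derivative [l (1 - e^l)]. *)
Lemma bernstein_expR (R : realType) (l : R) : 0 <= l ->
  (1 - l) * expR l <= 1 - l ^+ 2 / 2.
Proof.
move=> l0.
have : (1 - l) * expR l + l ^+ 2 / 2 <= (1 - 0) * expR 0 + 0 ^+ 2 / 2.
  apply: (@is_derive_le0_le R (fun l => (1 - l) * expR l + l ^+ 2 / 2)
    (fun l => l * (1 - expR l)) l _ _ l0).
    move=> y.
    apply: is_derive_eq.
    rewrite /GRing.scale /=; lra.
  move=> y y0; rewrite mulr_ge0_le0// subr_le0 -expR0 ler_expR //.
rewrite expR0; lra.
Qed.

(* The tilted mean [p e^l / (1 - p + p e^l)] has derivative at most [1/4] in [l]. *)
Lemma bernoulli_tilt (R : realType) (p l : R) : 0 <= p <= 1 -> 0 <= l ->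
  p * expR l <= (p + l / 4) * (1 - p + p * expR l).
Proof.
move=> /andP[p0 p1] l0.
pose D (l : R) := 1 - p + p * expR l.
have D0 y : 0 < D y.
  rewrite /D; have := expR_gt0 y => ey.
  have [->|p1'] := eqVneq p 1; first by rewrite subrr add0r mul1r.
  have : 0 <= p * expR y by rewrite mulr_ge0// ltW.
  have : p < 1 by rewrite lt_neqAle p1'.
  lra.
have : (1 - (1 - p) * (D l)^-1) - l / 4 <= (1 - (1 - p) * (D 0)^-1) - 0 / 4.
  apply: (@is_derive_le0_le R (fun l => (1 - (1 - p) * (D l)^-1) - l / 4)
     (fun l => (1 - p) * (p * expR l) / D l ^+ 2 - 1 / 4) l _ _ l0).
    move=> y.
    have dD : is_derive y (1 : R) D (p * expR y).
      apply: is_derive_eq; rewrite /GRing.scale /=; lra.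
    have dV := is_deriveV (lt0r_neq0 (D0 y)) dD.
    apply: is_derive_eq.
    rewrite /GRing.scale /=. lra.
  move=> y y0.
  rewrite subr_le0 ler_pdivrMr ?exprn_gt0// /D.
  (* AM-GM: [D y] is the sum of [1 - p] and [p e^y], whose product is thus at most
     [D y ^+ 2 / 4]. *)
  have := sqr_ge0 (1 - p - p * expR y); lra.
rewrite /D expR0 mulr1 subrK invr1 mulr1 mul0r subr0.
have -> : 1 - (1 - p) / (1 - p + p * expR l) = p * expR l / D l.
  by rewrite /D; field; exact: lt0r_neq0 (D0 l).
rewrite lerBlDr ler_pdivrMr // /D; lra.
Qed.

(** The quotient of the two sides is 1 at [l = 0], and [bernoulli_tilt] makes it decrease. *)
Lemma hoeffding_bernoulli_ge0 (R : realType) (p l : R) : 0 <= p <= 1 -> 0 <= l ->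
  1 - p + p * expR l <= expR (l * p + l ^+ 2 / 8).
Proof.
move=> p01 l0.
pose g (l : R) := (1 - p + p * expR l) * expR (- (l * p + l ^+ 2 / 8)).
have : g l <= g 0.
  apply: (@is_derive_le0_le R g (fun l => (p * expR l -
    (p + l / 4) * (1 - p + p * expR l)) * expR (- (l * p + l ^+ 2 / 8))) l _ _ l0).
    move=> y.
    have dE : is_derive y (1 : R) (fun l => - (l * p + l ^+ 2 / 8)) (- (p + y / 4)).
      apply: is_derive_eq; rewrite /GRing.scale /=; lra.
    have := @is_derive1_comp R expR _ y _ _ (is_derive_expR _) dE => dC.
    rewrite /g; apply: is_derive_eq; rewrite /GRing.scale /=; lra.
  move=> y y0; rewrite mulr_le0_ge0 ?expR_ge0// subr_le0.
  exact: bernoulli_tilt.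
rewrite /g expR0 mulr1 subrK mul0r expr0n mul0r addr0 oppr0 expR0 mulr1.
by rewrite expRN ler_pdivrMr ?expR_gt0// mul1r.
Qed.

Lemma hoeffding_bernoulli (R : realType) (p l : R) : 0 <= p <= 1 ->
  1 - p + p * expR l <= expR (l * p + l ^+ 2 / 8).
Proof.
move=> /andP[p0 p1]; have [l0|/ltW l0] := leP 0 l.
  by apply: hoeffding_bernoulli_ge0; rewrite ?p0.
have q01 : 0 <= 1 - p <= 1 by apply/andP; split; lra.
have := @hoeffding_bernoulli_ge0 _ _ (- l) q01.
rewrite oppr_ge0 => /(_ l0) => h.
(* Exchanging success and failure turns [l] into [- l] at the cost of a factor [e^l]. *)
have -> : l * p + l ^+ 2 / 8 = l + (- l * (1 - p) + (- l) ^+ 2 / 8) by field.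
rewrite expRD; apply: le_trans (ler_wpM2l (expR_ge0 _) h).
rewrite mulrDr mulrCA -expRD subrr expR0; lra.
Qed.

(** * Sums over the k-subsets of a finite type *)

(** This is ['C(#|T|, k)] times the expectation of [f X] for a hypergeometric [X]; leaving it
    unnormalised keeps the recursions free of divisions. *)
Definition sample_sum (R : realType) (T : finType) (A : {set T}) (k : nat)
  (f : nat -> R) : R := \sum_(S : {set T} | #|S| == k) f #|S :&: A|.

(** Double counting: removing a marked element of [B] from a [k.+1]-subset leaves a [k]-subset and
    an element of [B] outside it. *)
Lemma sum_subsets_setD1 (R : realType) (T : finType) (B : {set T}) (k : nat)
    (F : {set T} -> R) :
  \sum_(S : {set T} | #|S| == k.+1) \sum_(i in S :&: B) F (S :\ i) =
  \sum_(S : {set T} | #|S| == k) #|B :\: S|%:R * F S.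
Proof.
rewrite [RHS](eq_bigr (fun S => \sum_(i in B :\: S) F S)); last first.
  by move=> S _; rewrite sumr_const mulr_natl.
rewrite !pair_big_dep /=.
rewrite (reindex_onto (fun u : {set T} * T => (u.2 |: u.1, u.2))
                      (fun u => (u.1 :\ u.2, u.2))) /=; last first.
  by move=> [S i] /= /andP[_ /setIP[iS _]]; rewrite setD1K.
apply: eq_big => [[S i]|[S i]] /=; last first.
  by move=> /andP[_ /eqP[->]].
rewrite !inE eqxx /= cardsU1 xpair_eqE eqxx andbT.
case iS: (i \in S) => /=.
  rewrite andbF andbC; apply/negbTE/negP => /andP[/eqP SE _].
  by move: iS; rewrite -SE !inE eqxx.
by rewrite add1n eqSS setU1K ?iS // eqxx andbT.
Qed.

(** Marking a sampled hit and removing it leaves a [k]-sample with one hit fewer; the marked row is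
    one of the hits outside it. *)
Lemma sample_sum_hit (R : realType) (T : finType) (A : {set T}) (k : nat)
    (f : nat -> R) :
  sample_sum A k.+1 (fun x => x%:R * f x) =
  sample_sum A k (fun x => (#|A|%:R - x%:R) * f x.+1).
Proof.
rewrite /sample_sum [RHS](eq_bigr (fun S => #|A :\: S|%:R * f #|S :&: A|.+1)); last first.
  by move=> S _; rewrite cardsD natrB ?subset_leq_card ?subsetIl // setIC.
rewrite -(sum_subsets_setD1 _ _ (fun S => f #|S :&: A|.+1)).
apply: eq_bigr => S _.
rewrite (eq_bigr (fun=> f #|S :&: A|)) ?sumr_const ?mulr_natl // => i /setIP[iS iA].
by rewrite (cardsD1 i (S :&: A)) !inE iS iA /= setIDAC.
Qed.

Lemma sample_sum_miss (R : realType) (T : finType) (A : {set T}) (k : nat)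
    (f : nat -> R) :
  sample_sum A k.+1 (fun x => (k.+1%:R - x%:R) * f x) =
  sample_sum A k (fun x => (#|T|%:R - #|A|%:R - k%:R + x%:R) * f x).
Proof.
rewrite /sample_sum [RHS](eq_bigr (fun S => #|~: A :\: S|%:R * f #|S :&: A|)); last first.
  move=> S /eqP Sk; congr (_ * _).
  rewrite -Sk -(cardsC A) -(cardsID A S) -(cardsID S (~: A)).
  rewrite [~: A :&: S]setIC -setDE !natrD; ring.
rewrite -(sum_subsets_setD1 _ _ (fun S => f #|S :&: A|)).
apply: eq_bigr => S /eqP Sk.
rewrite (eq_bigr (fun=> f #|S :&: A|)) ?sumr_const; last first.
  move=> i /setIP[iS]; rewrite inE => iA; rewrite (_ : (S :\ i) :&: A = S :&: A) //.
  by apply/setP => j; rewrite !inE; case: eqVneq => // ->; rewrite (negbTE iA) !andbF.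
by rewrite -mulr_natl -setDE -Sk -(cardsID A S) natrD; ring.
Qed.

Lemma eq_sample_sum (R : realType) (T : finType) (A : {set T}) (k : nat)
    (f g : nat -> R) :
  (forall x, f x = g x) -> sample_sum A k f = sample_sum A k g.
Proof. by move=> fg; apply: eq_bigr => S _. Qed.

Lemma sample_sumD (R : realType) (T : finType) (A : {set T}) (k : nat)
    (f g : nat -> R) :
  sample_sum A k (fun x => f x + g x) = sample_sum A k f + sample_sum A k g.
Proof. exact: big_split. Qed.

Lemma sample_sumB (R : realType) (T : finType) (A : {set T}) (k : nat)
    (f g : nat -> R) :
  sample_sum A k (fun x => f x - g x) = sample_sum A k f - sample_sum A k g.
Proof. exact: sumrB. Qed.

Lemma sample_sumZ (R : realType) (T : finType) (A : {set T}) (k : nat)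
    (a : R) (f : nat -> R) :
  sample_sum A k (fun x => a * f x) = a * sample_sum A k f.
Proof. by rewrite /sample_sum mulr_sumr. Qed.

(** The comparison is asked only on the support of the hypergeometric law; the third condition says
    that the [k - x] misses fit outside [A]. *)
Lemma ler_sample_sum (R : realType) (T : finType) (A : {set T}) (k : nat)
    (f g : nat -> R) :
  (forall x, (x <= k)%N -> (x <= #|A|)%N -> (k <= #|T| - #|A| + x)%N -> f x <= g x) ->
  sample_sum A k f <= sample_sum A k g.
Proof.
move=> fg; apply: ler_sum => S /eqP Sk; apply: fg.
- by rewrite -Sk subset_leq_card ?subsetIl.
- by rewrite subset_leq_card ?subsetIr.
- rewrite -Sk -{1}(cardsID A S) addnC leq_add2r.
  by rewrite -(cardsC A) addKn subset_leq_card // setDE subsetIr.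
Qed.

Lemma sample_sum_cst (R : realType) (T : finType) (A : {set T}) (k : nat) (a : R) :
  sample_sum A k (fun=> a) = 'C(#|T|, k)%:R * a.
Proof.
rewrite /sample_sum sumr_const mulr_natl; congr (_ *+ _).
by rewrite -cardsE card_draws.
Qed.

Lemma sample_sum_setC (R : realType) (T : finType) (A : {set T}) (k : nat)
    (f : nat -> R) : (k <= #|T|)%N ->
  sample_sum A k f = sample_sum A (#|T| - k) (fun x => f (#|A| - x)%N).
Proof.
move=> kT; rewrite /sample_sum (reindex_onto (@setC T) (@setC T)) => [|S _]; last exact: setCK.
apply: eq_big => [S|S _].
  rewrite setCK eqxx andbT cardsCs setCK.
  have : (#|S| <= #|T|)%N by rewrite max_card.
  by move=> ST; apply/eqP/eqP => [<-|->]; rewrite subKn.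
by rewrite -(cardsID S A) [A :&: S]setIC addKn setDE setIC.
Qed.

(* Detailed balance of the chain that swaps a sampled row with an unsampled one. *)
Lemma sample_sum_stein (R : realType) (T : finType) (A : {set T}) (k : nat)
    (g : nat -> R) :
  sample_sum A k (fun x => (#|T|%:R * x%:R - k%:R * #|A|%:R) * g x) =
  sample_sum A k (fun x => (k%:R - x%:R) * (#|A|%:R - x%:R) * (g x.+1 - g x)).
Proof.
case: k => [|k].
  rewrite /sample_sum; apply: eq_bigr => S; rewrite cards_eq0 => /eqP ->.
  by rewrite set0I cards0 mulr0 !mul0r subrr !mul0r.
apply/eqP; rewrite -subr_eq0; apply/eqP.
(* [d x] counts the unsampled misses, so [x * d x] counts the swaps that lose a hit. Passing through
   the [k] rows kept by a swap, [e1] and [e2] have the same right-hand side. *)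
pose d (x : nat) : R := #|T|%:R - #|A|%:R - k.+1%:R + x%:R.
have e1 := sample_sum_hit A k (fun x => d x * g x).
have e2 := sample_sum_miss A k (fun x => (#|A|%:R - x%:R) * g x.+1).
have e3 : sample_sum A k.+1 (fun x => x%:R * (d x * g x)) =
   sample_sum A k.+1 (fun x => (k.+1%:R - x%:R) * ((#|A|%:R - x%:R) * g x.+1)).
  rewrite e1 e2; apply: eq_sample_sum => x.
  rewrite /d -!natr1; ring.
(* The rates of losing and of gaining a hit differ by [#|T| x - k.+1 #|A|], so the summands
   agree. *)
move: e3 => /eqP; rewrite -subr_eq0 => /eqP <-.
rewrite -!sample_sumB; apply: eq_sample_sum => x.
rewrite /d; ring.
Qed.

Lemma sample_sumS (R : realType) (T : finType) (A : {set T}) (k : nat)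
    (f : nat -> R) :
  k.+1%:R * sample_sum A k.+1 f =
  sample_sum A k (fun x => (#|A|%:R - x%:R) * f x.+1 +
                           (#|T|%:R - #|A|%:R - k%:R + x%:R) * f x).
Proof.
rewrite sample_sumD -sample_sum_hit -sample_sum_miss -sample_sumD -sample_sumZ.
by apply: eq_sample_sum => x; ring.
Qed.

(** * Moment generating function of the number of hits *)

Lemma hoeffding_sample_mgf (R : realType) (T : finType) (A : {set T}) (p : R)
    (k : nat) (l : R) :
  #|A|%:R = p * #|T|%:R -> (k <= #|T|)%N ->
  sample_sum A k (fun x => expR (l * (x%:R - k%:R * p))) <=
  'C(#|T|, k)%:R * expR (l ^+ 2 / 8 * (k%:R * (#|T|%:R - k%:R + 1) / #|T|%:R)).
Proof.
move=> Ap; elim: k l => [|k IH] l kT.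
  rewrite !mul0r mulr0 expR0 -(sample_sum_cst A); apply: ler_sample_sum => x.
  by rewrite leqn0 => /eqP -> _ _; rewrite subrr mulr0 expR0.
have n0 : 0 < #|T|%:R :> R by rewrite ltr0n; case: #|T| kT.
have N1 : 1 <= #|T|%:R - k%:R :> R by rewrite -natrB ?(ltnW kT)// ler1n subn_gt0.
have N0 : 0 < #|T|%:R - k%:R :> R by lra.
rewrite -(ler_pM2l (ltr0Sn R k)) sample_sumS.
set N := #|T|%:R - k%:R in N1 N0 *.
(* The next row is a hit with probability [p' = (#|A| - x) / N], and [p' - p = - (x - k p) / N];
   this shrinks the coefficient of [x - k p] from [l] to [l']. *)
pose l' := l * ((N - 1) / N).
have step : k.+1%:R * ('C(#|T|, k.+1)%:R * expR (l ^+ 2 / 8 *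
      (k.+1%:R * (#|T|%:R - k.+1%:R + 1) / #|T|%:R))) =
    N * expR (l ^+ 2 / 8 * (k.+1%:R * N / #|T|%:R)) * 'C(#|T|, k)%:R.
  have -> : #|T|%:R - k.+1%:R + 1 = N by rewrite -natr1 /N; ring.
  rewrite mulrA -natrM mul_bin_left natrM natrB ?(ltnW kT)// -/N; ring.
rewrite step.
apply: (@le_trans _ _ (N * expR (l ^+ 2 / 8) *
   sample_sum A k (fun x => expR (l' * (x%:R - k%:R * p))))).
  rewrite -sample_sumZ; apply: ler_sample_sum => x xk xA kx.
  pose p' := (#|A|%:R - x%:R) / N.
  have p'01 : 0 <= p' <= 1.
    rewrite divr_ge0 ?subr_ge0 ?ler_nat ?(ltnW kT)//=.
    rewrite ler_pdivrMr// mul1r /N.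
    have : k%:R <= #|T|%:R - #|A|%:R + x%:R :> R.
      by rewrite -natrB ?max_card// -natrD ler_nat.
    lra.
  have := hoeffding_bernoulli l p'01.
  rewrite -(ler_pM2l N0) => h.
  have := ler_wpM2r (expR_ge0 (l * (x%:R - k.+1%:R * p))) h.
  have -> : N * expR (l * p' + l ^+ 2 / 8) * expR (l * (x%:R - k.+1%:R * p)) =
      N * expR (l ^+ 2 / 8) * expR (l' * (x%:R - k%:R * p)).
    rewrite -!mulrA -!expRD; congr (_ * expR _).
    rewrite /l' /p' Ap -natr1 /N; field.
    exact: lt0r_neq0 N0.
  apply: le_trans; rewrite le_eqVlt; apply/orP; left; apply/eqP.
  have -> : expR (l * (x.+1%:R - k.+1%:R * p)) = expR l * expR (l * (x%:R - k.+1%:R * p)).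
    by rewrite -expRD -!natr1; congr expR; ring.
  rewrite /p' /N; field.
  exact: lt0r_neq0 N0.
apply: le_trans (ler_wpM2l _ (IH l' (ltnW kT))) _.
  by rewrite mulr_ge0 ?expR_ge0// ltW.
rewrite mulrACA -expRD [leRHS]mulrAC; apply: ler_wpM2l.
  by rewrite mulr_ge0// ltW.
rewrite ler_expR /l' -/N.
rewrite -subr_ge0.
(* The slack of the supersolution, nonnegative because a row is left to draw, that is [N >= 1]. *)
have -> : l ^+ 2 / 8 * (k.+1%:R * N / #|T|%:R) -
  (l ^+ 2 / 8 + (l * ((N - 1) / N)) ^+ 2 / 8 * (k%:R * (N + 1) / #|T|%:R)) =
  l ^+ 2 / 8 * (k%:R * (N - 1) / (N ^+ 2 * #|T|%:R)).
  have -> : k.+1%:R = #|T|%:R - N + 1 :> R by rewrite -natr1 /N; ring.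
  have -> : k%:R = #|T|%:R - N :> R by rewrite /N; ring.
  by field; rewrite !lt0r_neq0.
have N1' : 0 <= N - 1 by rewrite subr_ge0.
rewrite mulr_ge0 ?(divr_ge0 (sqr_ge0 l))// divr_ge0//.
  by rewrite mulr_ge0.
by rewrite (mulr_ge0 (sqr_ge0 N)) ?(ltW n0).
Qed.

Lemma hoeffding_sample_mgf_rho (R : realType) (T : finType) (A : {set T}) (p : R)
    (k : nat) (l : R) :
  #|A|%:R = p * #|T|%:R -> (0 < k)%N -> (k < #|T|)%N ->
  sample_sum A k (fun x => expR (l * (x%:R - k%:R * p))) <=
  'C(#|T|, k)%:R * expR (l ^+ 2 / 8 * (k%:R * rho_ R #|T| k)).
Proof.
move=> Ap k0 kT.
have kR : k%:R != 0 :> R by rewrite pnatr_eq0 -lt0n.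
have nR : #|T|%:R != 0 :> R by rewrite pnatr_eq0 -lt0n (leq_ltn_trans _ kT).
rewrite /rho_; case: ifP => _.
  have -> : k%:R * (1 - (k%:R - 1) / #|T|%:R) =
      k%:R * (#|T|%:R - k%:R + 1) / #|T|%:R :> R by field.
  exact: hoeffding_sample_mgf (ltnW kT).
(* In this branch the bound is applied to the [#|T| - k] unsampled rows, whose deviation from the
   mean is the opposite one, hence [- l]. *)
have -> : k%:R * ((1 - k%:R / #|T|%:R) * (1 + 1 / k%:R)) =
    (#|T| - k)%:R * (#|T|%:R - (#|T| - k)%:R + 1) / #|T|%:R :> R.
  by rewrite natrB ?(ltnW kT)//; field; rewrite kR nR.
rewrite -bin_sub ?(ltnW kT)// -[l ^+ 2]sqrrN sample_sum_setC ?(ltnW kT)//.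
apply: le_trans (hoeffding_sample_mgf (- l) Ap (leq_subr k #|T|)).
apply: ler_sample_sum => x _ xA _.
rewrite ler_expR !natrB ?(ltnW kT)// Ap le_eqVlt; apply/orP; left; apply/eqP; ring.
Qed.

(* Expand the nonpositive double sum of [(u x - u y) (g x - g y)]. *)
Lemma sample_sum_chebyshev (R : realType) (T : finType) (A : {set T}) (k : nat)
    (u g : nat -> R) :
  (forall x y, (x <= y)%N -> (y <= k)%N -> (y <= #|A|)%N -> u y <= u x) ->
  {homo g : x y / (x <= y)%N >-> x <= y} ->
  'C(#|T|, k)%:R * sample_sum A k (fun x => u x * g x) <=
  sample_sum A k u * sample_sum A k g.
Proof.
move=> uN gP; set C := 'C(_, _)%:R.
pose U := sample_sum A k u; pose G := sample_sum A k g.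
pose Z := sample_sum A k (fun x => u x * g x).
have inner x : sample_sum A k (fun y => (u x - u y) * (g x - g y)) =
    C * (u x * g x) - G * u x - U * g x + Z.
  rewrite [G * _]mulrC [U * _]mulrC /C -(sample_sum_cst A) -!sample_sumZ -!sample_sumB -sample_sumD.
  by apply: eq_sample_sum => y; ring.
have : sample_sum A k (fun x => sample_sum A k (fun y => (u x - u y) * (g x - g y))) <= 0.
  rewrite -(mulr0 C) -(sample_sum_cst A); apply: ler_sample_sum => x xk xA _.
  rewrite -(mulr0 C) -(sample_sum_cst A); apply: ler_sample_sum => y yk yA _.
  have [xy|/ltnW yx] := leqP x y.
    by rewrite mulr_ge0_le0 ?subr_ge0 ?subr_le0 ?uN ?gP.
  by rewrite mulr_le0_ge0 ?subr_ge0 ?subr_le0 ?uN ?gP.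
rewrite (eq_sample_sum _ _ inner) sample_sumD !sample_sumB !sample_sumZ sample_sum_cst.
rewrite -/C -/U -/G -/Z; lra.
Qed.

(** Up to the binomial coefficient this is [#|T|] times the variance of [X]. The Stein identity at
    [g = 1] and at [g x = x], with the expansion of the product, is a linear system for this sum and
    the first two moments. *)
Lemma sample_sum_up_rate (R : realType) (T : finType) (A : {set T}) (p : R) (k : nat) :
  #|A|%:R = p * #|T|%:R -> (1 < #|T|)%N ->
  sample_sum A k (fun x => (k%:R - x%:R) * (#|A|%:R - x%:R)) =
  'C(#|T|, k)%:R * (#|T|%:R *
     (k%:R * (#|T|%:R - k%:R) / (#|T|%:R - 1) * (p * (1 - p)))).
Proof.
move=> Ap T1; set n : R := #|T|%:R.
have n0 : n != 0 by rewrite pnatr_eq0 -lt0n ltnW.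
have n1 : n - 1 != 0 by rewrite subr_eq0 pnatr_eq1 neq_ltn T1 orbT.
set C : R := 'C(_, _)%:R.
pose S1 : R := sample_sum A k (fun x => x%:R).
pose S2 : R := sample_sum A k (fun x => x%:R * x%:R).
set U := LHS.
have e1 : n * S1 - C * (k%:R * #|A|%:R) = 0.
  have := sample_sum_stein A k (fun=> 1 : R).
  rewrite [RHS](@eq_sample_sum _ _ A k _ (fun=> 0)) => [|x]; last by rewrite subrr mulr0.
  rewrite sample_sum_cst mulr0 => <-.
  rewrite /C -(sample_sum_cst A) -sample_sumZ -sample_sumB.
  by apply: eq_sample_sum => x; rewrite mulr1.
have e2 : n * S2 - (k%:R * #|A|%:R) * S1 = U.
  have := sample_sum_stein A k (fun x => x%:R : R).
  rewrite [RHS](@eq_sample_sum _ _ A k _ (fun x => (k%:R - x%:R) * (#|A|%:R - x%:R))) => [e|x].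
    by rewrite /U -e -!sample_sumZ -sample_sumB; apply: eq_sample_sum => x; ring.
  by rewrite -natr1; ring.
have e3 : U = C * (k%:R * #|A|%:R) - (k%:R + #|A|%:R) * S1 + S2.
  rewrite /C -(sample_sum_cst A) -!sample_sumZ -sample_sumB -sample_sumD.
  by apply: eq_sample_sum => x; ring.
rewrite Ap -/n in e1 e2 e3.
have S1E : S1 = C * (k%:R * p).
  by apply: (mulfI n0); move/eqP: e1; rewrite subr_eq0 => /eqP ->; ring.
apply: (mulfI n1).
have -> : (n - 1) * U = n * U - U by ring.
have -> : n * U - U = n * (C * (k%:R * (p * n)) - (k%:R + p * n) * S1) + k%:R * (p * n) * S1.
  by rewrite -[X in _ - X]e2 e3; ring.
by rewrite S1E; field.
Qed.

Lemma is_derive_sum_fin (R : realType) (I : finType) (P : pred I) (h : I -> R -> R)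
    (dh : I -> R) (x : R) :
  (forall i, is_derive x 1 (h i) (dh i)) ->
  is_derive x 1 (fun y => \sum_(i | P i) h i y) (\sum_(i | P i) dh i).
Proof.
move=> hd; rewrite (_ : (fun y => _) = \sum_(i | P i) h i); last first.
  by apply/funext => y; rewrite fct_sumE.
by elim/big_ind2 : _ => // [|? ? ? ?]; [exact: is_derive_cst|exact: is_deriveD].
Qed.

Lemma bernstein_sample_mgf (R : realType) (T : finType) (A : {set T}) (p : R)
    (k : nat) (l : R) :
  #|A|%:R = p * #|T|%:R -> (1 < #|T|)%N -> (k <= #|T|)%N -> 0 <= l ->
  sample_sum A k (fun x => expR (l * (x%:R - k%:R * p))) <=
  'C(#|T|, k)%:R *
    expR (k%:R * (#|T|%:R - k%:R) / (#|T|%:R - 1) * (p * (1 - p)) * (expR l - 1 - l)).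
Proof.
move=> Ap T1 kT l0; set C : R := 'C(_, _)%:R.
have := sample_sum_up_rate k Ap T1; rewrite -/C.
set V := _ / _ * _; move: V => V uE.
pose M l : R := sample_sum A k (fun x => expR (l * (x%:R - k%:R * p))).
pose dM l : R := sample_sum A k (fun x => (x%:R - k%:R * p) * expR (l * (x%:R - k%:R * p))).
have n0 : 0 < #|T|%:R :> R by rewrite ltr0n ltnW.
have dMP y : is_derive y (1 : R) M (dM y).
  by apply: is_derive_sum_fin => S; exact: is_derive_expRM.
have dMle y : 0 <= y -> dM y <= V * (expR y - 1) * M y.
  move=> y0.
  have ey : 0 <= expR y - 1 by rewrite subr_ge0 -expR0 ler_expR.
  have C0 : 0 < C.
    by rewrite ltr0n bin_gt0.
  pose g (x : nat) : R := expR (y * (x%:R - k%:R * p)).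
  pose u (x : nat) : R := (k%:R - x%:R) * (#|A|%:R - x%:R).
  (* Stein identity for an exponential, whose increment is [expR y - 1] times itself. *)
  have e1 : #|T|%:R * dM y = (expR y - 1) * sample_sum A k (fun x => u x * g x).
    rewrite -!sample_sumZ.
    transitivity (sample_sum A k (fun x => (#|T|%:R * x%:R - k%:R * #|A|%:R) * g x)).
      by apply: eq_sample_sum => x; rewrite Ap /g; ring.
    rewrite sample_sum_stein; apply: eq_sample_sum => x.
    have -> : g x.+1 = expR y * g x.
      by rewrite /g -expRD -natr1; congr expR; ring.
    by rewrite /u; ring.
  have h : C * sample_sum A k (fun x => u x * g x) <= sample_sum A k u * M y.
    apply: sample_sum_chebyshev => [x z xz zk zA|x z xz].
      have : x%:R <= z%:R :> R by rewrite ler_nat.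
      have : z%:R <= k%:R :> R by rewrite ler_nat.
      have : z%:R <= #|A|%:R :> R by rewrite ler_nat.
      by move=> h1 h2 h3; rewrite ler_pM// ?subr_ge0// ?lerB.
    by rewrite ler_expR ler_wpM2l// lerB// ler_nat.
  rewrite uE -!mulrA ler_pM2l// in h.
  rewrite -(ler_pM2l n0) e1.
  have := ler_wpM2l ey h; rewrite mulrA => /le_trans; apply.
  by rewrite le_eqVlt; apply/orP; left; apply/eqP; ring.
(* Gronwall's argument: by [dMle], [M] times this integrating factor decreases on [l >= 0]. *)
pose f l := M l * expR (- (V * (expR l - 1 - l))).
have : f l <= f 0.
  apply: (@is_derive_le0_le R f (fun l => (dM l - V * (expR l - 1) * M l) *
     expR (- (V * (expR l - 1 - l)))) l _ _ l0).
    move=> y.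
    have dE : is_derive y (1 : R) (fun l => - (V * (expR l - 1 - l))) (- (V * (expR y - 1))).
      apply: is_derive_eq; rewrite /GRing.scale /=; ring.
    have := @is_derive1_comp R expR _ y _ _ (is_derive_expR _) dE => dC.
    rewrite /f; apply: is_derive_eq; rewrite /GRing.scale /=; ring.
  by move=> y y0; rewrite mulr_le0_ge0 ?expR_ge0// subr_le0 dMle.
rewrite /f expR0 subrr subrr mulr0 oppr0 expR0 mulr1 expRN ler_pdivrMr ?expR_gt0//.
have -> : M 0 = C.
  rewrite -[RHS]mulr1 -(sample_sum_cst A); apply: eq_sample_sum => x.
  by rewrite mul0r expR0.
by [].
Qed.

(** * Tail bounds *)

Lemma rho_gt0 (R : realType) (n k : nat) : (0 < k)%N -> (k < n)%N -> 0 < rho_ R n k.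
Proof.
move=> k0 kn.
have kR : 0 < k%:R :> R by rewrite ltr0n.
have nR : 0 < n%:R :> R by rewrite ltr0n (leq_ltn_trans _ kn).
have knR : k%:R < n%:R :> R by rewrite ltr_nat.
rewrite /rho_; case: ifP => _.
  by rewrite subr_gt0 ltr_pdivrMr// mul1r ltrBlDr (lt_trans knR)// ltrDl.
rewrite mulr_gt0//; first by rewrite subr_gt0 ltr_pdivrMr// mul1r.
by rewrite addr_gt0// divr_gt0.
Qed.

(** After cancelling [k] and clearing [n - 1], the slack is [(k - 1) / n] or
    [(n - k) (n - k - 1) / (n k)], according to the branch of [rho_]. *)
Lemma variance_le_rho (R : realType) (n k : nat) : (1 < n)%N -> (0 < k)%N -> (k < n)%N ->
  k%:R * (n%:R - k%:R) / (n%:R - 1) <= k%:R * rho_ R n k.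
Proof.
move=> n1 k0 kn.
have kR : 1 <= k%:R :> R by rewrite ler1n.
have kR0 : 0 < k%:R :> R by rewrite ltr0n.
have nR : 0 < n%:R - 1 :> R by rewrite subr_gt0 ltr1n.
have nR0 : 0 < n%:R :> R by rewrite ltr0n ltnW.
have knR : k%:R + 1 <= n%:R :> R by rewrite natr1 ler_nat.
rewrite -mulrA ler_pM2l// ler_pdivrMr// -subr_ge0 /rho_; case: ifP => _.
  have -> : (1 - (k%:R - 1) / n%:R) * (n%:R - 1) - (n%:R - k%:R) =
      (k%:R - 1) / n%:R :> R by field; exact: lt0r_neq0.
  by rewrite divr_ge0 ?subr_ge0// ltW.
have -> : (1 - k%:R / n%:R) * (1 + 1 / k%:R) * (n%:R - 1) - (n%:R - k%:R) =
    (n%:R - k%:R) * (n%:R - (k%:R + 1)) / (n%:R * k%:R) :> R.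
  by field; rewrite !lt0r_neq0.
by rewrite divr_ge0 ?mulr_ge0 ?ler0n ?subr_ge0// ler_nat ltnW.
Qed.

Lemma zeta_ge1 (R : realType) (n k : nat) : 1 <= zeta_ R n k.
Proof.
by rewrite /zeta_; case: ifP => _; rewrite -[leLHS]addr0 lerD ?sqrtr_ge0//; lra.
Qed.

(** Markov's inequality for [expR (l (X - k p))]; [b] bounds the logarithm of its expectation. *)
Lemma sample_chernoff (R : realType) (T : finType) (A : {set T}) (p d b l : R) (k : nat) :
  0 <= l ->
  sample_sum A k (fun x => expR (l * (x%:R - k%:R * p))) <= 'C(#|T|, k)%:R * expR b ->
  sample_sum A k (fun x => (k%:R * d <= x%:R - k%:R * p)%R%:R) <=
  'C(#|T|, k)%:R * expR (b - l * (k%:R * d)).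
Proof.
move=> l0 h; rewrite expRD mulrA.
apply: le_trans (ler_wpM2r (expR_ge0 _) h).
rewrite [leRHS]mulrC -sample_sumZ; apply: ler_sample_sum => x _ _ _.
rewrite -expRD; case: (leP (k%:R * d)) => [hx|_]; last exact: expR_ge0.
apply: (@le_trans _ _ (expR 0)); first by rewrite expR0.
by rewrite ler_expR [leRHS]addrC subr_ge0 ler_wpM2l.
Qed.

(* With [D = sqrt (v + 2 z d)] and [b = sqrt v], the bound is [(D - b)^2 / (2 z^2)]
   and it is attained at [l = (D - b) / (z D)], which is [0] when [D = 0]. *)
Lemma bernstein_exponent (R : realType) (v z d : R) : 0 <= v -> 1 <= z -> 0 <= d ->
  exists2 l, 0 <= l & v * (expR l - 1 - l) - l * d <=
    - (- Num.sqrt (2 * z * v * d + v ^+ 2) + d * z + v) / z ^+ 2.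
Proof.
move=> v0 z1 d0; have z0 : 0 < z by exact: lt_le_trans z1.
pose b := Num.sqrt v; pose D := Num.sqrt (v + 2 * z * d).
have zd0 : 0 <= 2 * z * d by rewrite !mulr_ge0 // ltW.
have bE : b ^+ 2 = v by rewrite sqr_sqrtr.
have DE : D ^+ 2 = v + 2 * z * d by rewrite sqr_sqrtr// addr_ge0.
have b0 : 0 <= b by exact: sqrtr_ge0.
have bD : b <= D by rewrite ler_wsqrtr// lerDl.
have -> : Num.sqrt (2 * z * v * d + v ^+ 2) = b * D.
  by rewrite -sqrtrM//; congr Num.sqrt; ring.
have -> : - (- (b * D) + d * z + v) / z ^+ 2 = - ((D - b) ^+ 2 / (2 * z ^+ 2)).
  have -> : d * z = (D ^+ 2 - b ^+ 2) / 2 by rewrite DE bE; field.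
  by rewrite -bE; field; exact: lt0r_neq0.
have [D0|Dn0] := eqVneq D 0.
  have b00 : b = 0 by apply/eqP; rewrite eq_le b0 -D0 bD.
  exists 0 => //; rewrite D0 b00 expR0 !subrr mulr0 mul0r subrr expr0n mul0r.
  by rewrite oppr0.
have D0 : 0 < D by rewrite lt_neqAle eq_sym Dn0 (le_trans b0).
pose l := (D - b) / (z * D).
have l0 : 0 <= l by rewrite divr_ge0 ?subr_ge0// mulr_ge0// ltW.
exists l => //.
have dE : d = (D ^+ 2 - b ^+ 2) / (2 * z) by rewrite DE bE; field; exact: lt0r_neq0.
suff h : v * (expR l - 1 - l) <= b * (D - b) ^+ 2 / (2 * z ^+ 2 * D).
  have -> : - ((D - b) ^+ 2 / (2 * z ^+ 2)) =
      b * (D - b) ^+ 2 / (2 * z ^+ 2 * D) - l * d.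
    by rewrite dE /l; field; rewrite !lt0r_neq0.
  by rewrite lerB.
have e0 : 0 <= expR l - 1 - l by have := expR_ge1Dx l; lra.
have h1 : (1 - z * l) * (expR l - 1 - l) <= l ^+ 2 / 2.
  apply: (@le_trans _ _ ((1 - l) * (expR l - 1 - l))).
    by rewrite ler_wpM2r// lerB// ler_peMl.
  have := bernstein_expR l0; lra.
(* This is what the choice of [l] achieves: multiplying [h1] by [b D] now puts [v = b^2] in front of
   [expR l - 1 - l]. *)
have zl : 1 - z * l = b / D by rewrite /l; field; rewrite !lt0r_neq0.
rewrite zl in h1.
have := ler_wpM2l (mulr_ge0 b0 (ltW D0)) h1.
have -> : b * D * (b / D * (expR l - 1 - l)) = v * (expR l - 1 - l).
  by rewrite -bE; field.
have -> // : b * D * (l ^+ 2 / 2) = b * (D - b) ^+ 2 / (2 * z ^+ 2 * D).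
by rewrite /l; field; rewrite !lt0r_neq0.
Qed.

Lemma sample_tail_bound (R : realType) (T : finType) (A : {set T}) (p d : R) (k : nat) :
  #|A|%:R = p * #|T|%:R -> (1 < #|T|)%N -> (0 < k)%N -> (k < #|T|)%N ->
  0 <= p <= 1 -> 0 <= d ->
  sample_sum A k (fun x => (k%:R * d <= x%:R - k%:R * p)%R%:R) <=
  'C(#|T|, k)%:R * tail_bound #|T| k p d.
Proof.
move=> Ap T1 k0 kT /andP[p0 p1] d0; rewrite /tail_bound.
have r0 := rho_gt0 R k0 kT; have z1 := zeta_ge1 R #|T| k.
have vr := variance_le_rho R T1 k0 kT.
set r := rho_ R _ _ in r0 vr *; set z := zeta_ R _ _ in z1 *.
have C0 : 0 <= 'C(#|T|, k)%:R :> R by rewrite ler0n.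
have s0 : 0 <= p * (1 - p) by rewrite mulr_ge0// subr_ge0.
set s2 := p * (1 - p) in s0 *.
have hB : sample_sum A k (fun x => (k%:R * d <= x%:R - k%:R * p)%R%:R) <=
  'C(#|T|, k)%:R * (2 * expR (- (k%:R / z ^+ 2) *
       (- Num.sqrt (2 * z * r * s2 * d + r ^+ 2 * s2 ^+ 2) + d * z + s2 * r))).
  have [l l0 hl] := bernstein_exponent (mulr_ge0 (ltW r0) s0) z1 d0.
  have := sample_chernoff d l0 (bernstein_sample_mgf Ap T1 (ltnW kT) l0).
  move=> /le_trans; apply; apply: ler_wpM2l => //.
  apply: (@le_trans _ _ (1 * expR (- (k%:R / z ^+ 2) *
       (- Num.sqrt (2 * z * r * s2 * d + r ^+ 2 * s2 ^+ 2) + d * z + s2 * r)))); last first.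
    by rewrite ler_wpM2r ?expR_ge0// ler1n.
  rewrite mul1r ler_expR.
  have e0 : 0 <= expR l - 1 - l by have := expR_ge1Dx l; lra.
  apply: (@le_trans _ _ (k%:R * (r * s2 * (expR l - 1 - l) - l * d))).
    have := ler_wpM2r e0 (ler_wpM2r s0 vr); rewrite -/s2; lra.
  have := ler_wpM2l (ler0n R k) hl.
  rewrite exprMn -[2 * z * (r * s2) * d]/(2 * z * (r * s2) * d) mulrA [s2 * r]mulrC.
  by move=> /le_trans; apply; rewrite le_eqVlt; apply/orP; left; apply/eqP; ring.
have hH : sample_sum A k (fun x => (k%:R * d <= x%:R - k%:R * p)%R%:R) <=
  'C(#|T|, k)%:R * expR (- (2 * k%:R * d ^+ 2) / r).
  (* [4 d / r] minimises [l^2 k r / 8 - l k d], with minimum [- 2 k d^2 / r]. *)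
  have l0 : 0 <= 4 * d / r by rewrite divr_ge0 ?mulr_ge0// ltW.
  have := sample_chernoff d l0 (hoeffding_sample_mgf_rho (4 * d / r) Ap k0 kT).
  move=> /le_trans; apply; apply: ler_wpM2l => //.
  rewrite ler_expR -/r le_eqVlt; apply/orP; left; apply/eqP; field.
  exact: lt0r_neq0.
by rewrite /Order.min; case: ifP.
Qed.

(** * Reduction of the Q-error to the two tails *)

Lemma tail_boundC (R : realType) (n k : nat) (p d : R) :
  tail_bound n k (1 - p) d = tail_bound n k p d.
Proof. by rewrite /tail_bound (_ : (1 - p) * (1 - (1 - p)) = p * (1 - p)) //; ring. Qed.

(** The true cardinality is at least 1, so clamping can only change the estimate. A large first
    quotient gives the lower deviation, a large second one the upper deviation. *)
Lemma qerror_gt (R : realType) (n k x : nat) (p q : R) :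
  (0 < n)%N -> (0 < k)%N -> 1 <= p * n%:R -> 1 <= q ->
  q < qerror (n%:R / k%:R * x%:R) (p * n%:R) ->
  k%:R * (p * q - p) <= x%:R - k%:R * p \/ k%:R * (p - p / q) <= k%:R * p - x%:R.
Proof.
move=> n0 k0 pn q1; rewrite /qerror [Num.max (p * _) 1]max_l//.
set e := Num.max _ 1; set t := p * n%:R in pn *.
have nR : 0 < n%:R :> R by rewrite ltr0n.
have kR : 0 < k%:R :> R by rewrite ltr0n.
have t0 : 0 < t by exact: lt_le_trans pn.
have q0 : 0 < q by exact: lt_le_trans q1.
have e0 : 0 < e by rewrite /e lt_max ltr01 orbT.
have nk : n%:R / k%:R * x%:R = x%:R / k%:R * n%:R :> R by ring.
rewrite lt_max !ltr_pdivlMr// => /orP[h|h].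
  right; have : q * (n%:R / k%:R * x%:R) < t.
    by apply: le_lt_trans h; rewrite ler_pM2l// /e le_max lexx.
  rewrite nk /t mulrA ltr_pM2r// mulrA ltr_pdivrMr// -ltr_pdivlMl// => h'.
  by rewrite mulrBr lerB// ltW// (_ : _ * (p / q) = q^-1 * (p * k%:R)) //; ring.
(* As [q * t >= 1], the clamp value 1 cannot exceed it, so the raw estimate does. *)
left; have : q * t < n%:R / k%:R * x%:R.
  move: h; rewrite /e lt_max => /orP[//|].
  by rewrite ltNge -[X in X <= _]mulr1 ler_pM.
rewrite nk /t mulrA ltr_pM2r// ltr_pdivlMr// => h'.
by rewrite mulrBr lerB// ltW// mulrC [p * q]mulrC.
Qed.

Unset Implicit Arguments.
Theorem theorem2 (R : realType) (T : Type) (n k : nat) (t : 'I_n -> T)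
  (P : pred T) (p q : R) :
  (2 <= n)%N -> (1 <= k)%N -> (k < n)%N ->
  0 < p -> p <= 1 ->
  (#|[set i : 'I_n | P (t i)]|)%:R = p * n%:R ->
  1 <= q ->
  prob_qerror_le k (fun i => P (t i)) p q >= 1 - Omega n k p q - Psi n k p q.
Proof.
move=> n2 k1 kn p0 p1 Ap q1; set A := [set i | _] in Ap.
have n0 : (0 < n)%N by exact: ltnW.
have q0 : 0 < q by exact: lt_le_trans q1.
have pn1 : 1 <= p * n%:R.
  by rewrite -Ap ler1n -(ltr0n R) Ap mulr_gt0// ltr0n.
have C0 : 0 < 'C(n, k)%:R :> R by rewrite ltr0n bin_gt0 ltnW.
have up : sample_sum A k (fun x => (k%:R * (p * q - p) <= x%:R - k%:R * p)%R%:R) <=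
    'C(n, k)%:R * Omega n k p q.
  have := @sample_tail_bound R _ A p (p * q - p) k.
  rewrite card_ord; apply => //; first by rewrite (ltW p0).
  by rewrite subr_ge0 ler_peMr// ltW.
(* Few hits in [A] means many in its complement, of proportion [1 - p]; the deviation remains
   [p - p / q], and [tail_boundC] brings the bound back to [p]. *)
have down : sample_sum (~: A) k
    (fun x => (k%:R * (p - p / q) <= x%:R - k%:R * (1 - p))%R%:R) <=
    'C(n, k)%:R * Psi n k p q.
  rewrite /Psi -tail_boundC.
  have := @sample_tail_bound R _ (~: A) (1 - p) (p - p / q) k.
  rewrite card_ord; apply => //.
  - by have := congr1 (fun m => m%:R : R) (cardsC A); rewrite card_ord natrD Ap; lra.
  - by rewrite subr_ge0 p1 lerBlDr lerDl ltW.
  - by rewrite subr_ge0 ler_pdivrMr// ler_peMr// ltW.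
rewrite /prob_qerror_le ler_pdivlMr//.
have -> : (1 - Omega n k p q - Psi n k p q) * 'C(n, k)%:R =
   'C(n, k)%:R - 'C(n, k)%:R * Omega n k p q - 'C(n, k)%:R * Psi n k p q by ring.
rewrite !lerBlDr; apply: le_trans (lerD (lerD (lexx _) down) up).
(* Union bound, sample by sample: 1 is at most the sum of the indicators of a Q-error at most [q]
   and of the two tails. *)
rewrite -[leLHS]mulr1 -{1}(card_ord n) -(sample_sum_cst A) /sample_sum.
rewrite -sum1_card natr_sum; under [X in _ <= X + _ + _]eq_bigl do rewrite inE.
rewrite big_mkcondr -!big_split; apply: ler_sum => S /eqP Sk /=.
rewrite -/A.
have qe := @qerror_gt R n k #|S :&: A| p q n0 k1 pn1 q1.
case: (leP (qerror _ _)) => [_|/qe[h|h]].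
- by rewrite -addrA lerDl addr_ge0 ?ler0n.
- by rewrite h lerDr ?addr_ge0 ?ler0n.
- have -> : k%:R * (p - p / q) <= #|S :&: ~: A|%:R - k%:R * (1 - p).
    have -> : #|S :&: ~: A|%:R = k%:R - #|S :&: A|%:R :> R.
      by rewrite -Sk -(cardsID A S) setDE natrD; ring.
    by move: h; rewrite mulrBr [k%:R * (1 - p)]mulrBr; lra.
  by rewrite add0r lerDl ler0n.
Qed.
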